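(* Let $E := L^0(\mathbb{C},\mu)$ be the complex topological vector space of equivalence classes of measurable functions $\mathbb{C}\to\mathbb{C}$ (modulo functions vanishing $\mu$-almost everywhere) with the topology of convergence in measure, where $\mu$ is the Gauss measure on $\mathbb{C}=\mathbb{R}^2$. Let $f\colon \mathbb{C}\to E$, $f(z):=\mathbf{1}_{A(z)}$, where $A(z):=\{w\in\mathbb{C} : |z|\le |w|\le 1\}$. Then $f$ is of class $C^\infty_{\mathbb{C}}$, $f$ is non-zero, and $f$ has compact support (i.e. the closure of $\{z\in\mathbb{C}: f(z)\neq 0\}$ in $\mathbb{C}$ is compact).
   Context: Gauss measure: $d\nu(x)=\frac{1}{\sqrt{\pi}}e^{-x^2}\,dx$ on $\mathbb{R}$ and $\mu:=\nu\otimes\nu$ on $\mathbb{C}=\mathbb{R}^2$. Topology on $E=L^0(\mathbb{C},\mu)$: a basis of open zero-neighbourhoods is given by the sets $W_k$, $k\in\mathbb{N}$, consisting of the classes of measurable $\gamma\colon\mathbb{C}\to\mathbb{C}$ with $\mu(\{z\in\mathbb{C}: |\gamma(z)|\ge \frac1k\})<\frac1k$. For measurable $A\subseteq\mathbb{C}$, $\mathbf{1}_A$ denotes (the class of) the characteristic function of $A$. Differentiability classes: let $\mathbb{K}$ be a non-discrete topological field (here $\mathbb{K}=\mathbb{C}$), $U\subseteq\mathbb{K}$ open, $E$ a Hausdorff topological $\mathbb{K}$-vector space and $f\colon U\to E$ a map. $f$ is of class $C^0_{\mathbb{K}}$ if it is continuous; then $f^{<0>}:=f$. Recursively, for $k\in\mathbb{N}$,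 $f$ is of class $C^k_{\mathbb{K}}$ if it is of class $C^{k-1}_{\mathbb{K}}$ and there is a continuous map $f^{<k>}\colon U^{k+1}\to E$ such that $$f^{<k>}(x_1,\ldots,x_{k+1})=\frac{1}{x_1-x_2}\left(f^{<k-1>}(x_1,x_3,\ldots,x_{k+1})-f^{<k-1>}(x_2,x_3,\ldots,x_{k+1})\right)$$ for all $(x_1,\ldots,x_{k+1})\in U^{k+1}$ with $x_1\ne x_2$ (such $f^{<k>}$ is unique). $f$ is of class $C^\infty_{\mathbb{K}}$ if it is of class $C^k_{\mathbb{K}}$ for all $k\in\mathbb{N}_0$. *)

(* Defs.v *)
From HB Require Import structures.
From mathcomp Require Import all_boot all_order all_algebra.
From mathcomp Require Import complex.
From mathcomp Require Import all_classical all_reals all_analysis.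
From mathcomp Require Import measurable_realfun normal_distribution.

Set Implicit Arguments.
Unset Strict Implicit.
Unset Printing Implicit Defensive.
Import Order.TTheory GRing.Theory Num.Theory.
Import numFieldNormedType.Exports.
Local Open Scope classical_set_scope.
Local Open Scope ring_scope.

#[warning="-redundant-canonical-projection"]
HB.instance Definition _ (R : realType) := NormedModule.copy R[i] R[i]^o.

Section complex_measurable.
Context {R : realType}.

Definition complex_of_pair (p : R * R) : R[i] := (p.1 +i* p.2)%C.

(* The sigma-algebra of C = R^2: the Borel sets of the plane. *)
Definition complex_measurable : set (set R[i]) :=
  [set A | measurable (complex_of_pair @^-1` A)].

Let complex_measurable0 : complex_measurable set0.
Proof. by rewrite /complex_measurable/= preimage_set0. Qed.

Let complex_measurableC A : complex_measurable A -> complex_measurable (~` A).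
Proof. by rewrite /complex_measurable/= preimage_setC; exact: measurableC. Qed.

Let complex_measurable_bigcup (F : (set R[i])^nat) :
  (forall i, complex_measurable (F i)) -> complex_measurable (\bigcup_i F i).
Proof.
move=> mF; rewrite /complex_measurable/= preimage_bigcup.
by apply: bigcupT_measurable => i; exact: mF.
Qed.

HB.instance Definition _ := isMeasurable.Build default_measure_display R[i]
  complex_measurable0 complex_measurableC complex_measurable_bigcup.

Lemma measurable_complex_of_pair : measurable_fun setT complex_of_pair.
Proof. by move=> _ A mA; rewrite setTI. Qed.

HB.instance Definition _ :=
  isMeasurableFun.Build _ _ _ _ complex_of_pair measurable_complex_of_pair.

Lemma measurable_Re : measurable_fun setT (@complex.Re R).
Proof.
move=> _ A mA; rewrite setTI.
have := @measurable_fst _ _ R R measurableT A mA; rewrite setTI.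
by [].
Qed.

Lemma measurable_Im : measurable_fun setT (@complex.Im R).
Proof.
move=> _ A mA; rewrite setTI.
have := @measurable_snd _ _ R R measurableT A mA; rewrite setTI.
by [].
Qed.

Lemma measurable_complexP d (T : measurableType d) (f : T -> R[i]) :
  measurable_fun setT f <-> measurable_fun setT (@complex.Re R \o f) /\
                            measurable_fun setT (@complex.Im R \o f).
Proof.
split=> [mf|[mr mi]].
  by split; apply: measurableT_comp => //; [exact: measurable_Re|exact: measurable_Im].
rewrite (_ : f = complex_of_pair \o (fun t => (complex.Re (f t), complex.Im (f t)))).
  apply: measurableT_comp; first exact: measurable_complex_of_pair.
  exact: measurable_fun_pair.
by apply/funext => t /=; rewrite /complex_of_pair/=; case: (f t).
Qed.

Lemma measurable_normc : measurable_fun setT (@ComplexField.Normc.normc R).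
Proof.
rewrite (_ : @ComplexField.Normc.normc R =
  Num.sqrt \o (fun z => complex.Re z ^+ 2 + complex.Im z ^+ 2)); last first.
  by apply/funext => -[].
apply: measurableT_comp => //.
  by apply: continuous_measurable_fun; exact: sqrt_continuous.
by apply: measurable_funD; apply: measurable_funX;
  [exact: measurable_Re|exact: measurable_Im].
Qed.

End complex_measurable.

Section complex_valued.
Context d (T : measurableType d) (R : realType).
Implicit Types f g : T -> R[i].

Lemma measurable_complexD f g : measurable_fun setT f -> measurable_fun setT g ->
  measurable_fun setT (fun t => f t + g t).
Proof.
move=> /measurable_complexP[fr fi] /measurable_complexP[gr gi].
apply/measurable_complexP; split.
- rewrite (_ : _ \o _ = (@complex.Re R \o f) \+ (@complex.Re R \o g)).
    exact: measurable_funD.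
  by apply/funext => t /=; case: (f t) (g t) => [? ?] [].
- rewrite (_ : _ \o _ = (@complex.Im R \o f) \+ (@complex.Im R \o g)).
    exact: measurable_funD.
  by apply/funext => t /=; case: (f t) (g t) => [? ?] [].
Qed.

Lemma measurable_complexZ (a : R[i]) f : measurable_fun setT f ->
  measurable_fun setT (fun t => a * f t).
Proof.
move=> /measurable_complexP[fr fi]; apply/measurable_complexP; split.
- rewrite (_ : _ \o _ = (fun t => complex.Re a * (@complex.Re R \o f) t
                                - complex.Im a * (@complex.Im R \o f) t)).
    by apply: measurable_funB; apply: measurable_funM.
  by apply/funext => t /=; case: a (f t) => [? ?] [].
- rewrite (_ : _ \o _ = (fun t => complex.Re a * (@complex.Im R \o f) t
                                + complex.Im a * (@complex.Re R \o f) t)).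
    by apply: measurable_funD; apply: measurable_funM.
  by apply/funext => t /=; case: a (f t) => [? ?] [].
Qed.

Lemma measurable_complex_indic (A : set T) : measurable A ->
  measurable_fun setT (\1_A : T -> R[i]).
Proof.
move=> mA; apply/measurable_complexP; split.
- rewrite (_ : _ \o _ = \1_A); first exact: measurable_indic.
  by apply/funext => t /=; rewrite !indicE; case: (t \in A).
- rewrite (_ : _ \o _ = cst 0); first exact: measurable_cst.
  by apply/funext => t /=; rewrite !indicE; case: (t \in A).
Qed.

End complex_valued.

Section gauss.
Context (R : realType).

Definition gauss_measure1 : set R -> \bar R := fun A =>
  (\int[lebesgue_measure]_(x in A)
     ((Num.sqrt pi)^-1 * expR (- x ^+ 2))%:E)%E.

Lemma gauss_measure1E : gauss_measure1 = normal_prob 0 (Num.sqrt 2)^-1.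
Proof.
apply/funext => A; rewrite /gauss_measure1 /normal_prob.
apply: eq_integral => x _; congr EFin.
have s2 : Num.sqrt 2 != 0 :> R by rewrite gt_eqF// sqrtr_gt0.
rewrite normal_pdfE ?invr_eq0// /normal_peak /normal_fun subr0.
have e2 : (Num.sqrt 2)^-1 ^+ 2 *+ 2 = 1 :> R.
  have two0 : (0 <= 2 :> R) by rewrite ler0n.
  have two1 : (2 != 0 :> R) by rewrite pnatr_eq0.
  by rewrite exprVn (sqr_sqrtr two0) -mulr_natr mulVf.
by rewrite -mulrnAl e2 mul1r divr1.
Qed.

Let gauss0 : gauss_measure1 set0 = 0%E.
Proof. by rewrite gauss_measure1E measure0. Qed.

Let gauss_ge0 A : (0 <= gauss_measure1 A)%E.
Proof. by rewrite gauss_measure1E measure_ge0. Qed.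

Let gauss_additive : semi_sigma_additive gauss_measure1.
Proof.
rewrite gauss_measure1E.
exact: (@measure_semi_sigma_additive _ _ _ (normal_prob 0 _)).
Qed.

HB.instance Definition _ := isMeasure.Build _ R R gauss_measure1
  gauss0 gauss_ge0 gauss_additive.

Let gauss_setT : gauss_measure1 setT = 1%E.
Proof. by rewrite gauss_measure1E; exact: (@probability_setT _ _ _ (normal_prob _ _)). Qed.

HB.instance Definition _ := Measure_isProbability.Build _ R R gauss_measure1
  gauss_setT.

Definition gauss_measure : probability R[i] R :=
  distribution (gauss_measure1 \x gauss_measure1)%E complex_of_pair.

End gauss.

(* Classes of C-valued measurable functions on a probability space, with the
   topology of convergence in measure. *)
Section L0.
Context d (T : measurableType d) (R : realType) (P : probability T R).
Local Open Scope quotient_scope.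

Definition L0 : Type := {mfun_ P, T >-> R[i]}.
HB.instance Definition _ := Choice.on L0.
HB.instance Definition _ := EqQuotient.on L0.

Definition mk_mfun (f : T -> R[i]) (mf : measurable_fun setT f) :
  {mfun T >-> R[i]} := mfun_Sub (mem_set mf).

Lemma pi_L0P (f g : {mfun T >-> R[i]}) :
  \pi_L0 f = \pi_L0 g <-> {ae P, forall t, f t = g t}.
Proof.
split=> [/eqmodP/asboolP fg|fg].
- by apply: filterS fg => t; exact.
- by apply/eqmodP/asboolP; apply: filterS fg => t.
Qed.

Let mfunD (f g : {mfun T >-> R[i]}) := mk_mfun
  (measurable_complexD (@measurable_funPT _ _ _ _ f) (@measurable_funPT _ _ _ _ g)).

Let mfunZ (a : R[i]) (f : {mfun T >-> R[i]}) := mk_mfun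
  (measurable_complexZ a (@measurable_funPT _ _ _ _ f)).

Definition L0_add (x y : L0) : L0 := \pi_L0 (mfunD (repr x) (repr y)).
Definition L0_scale (a : R[i]) (x : L0) : L0 := \pi_L0 (mfunZ a (repr x)).
Definition L0_zero : L0 := \pi_L0 (mk_mfun (@measurable_cst _ _ T R[i] setT 0)).

Let repr_pi (f : {mfun T >-> R[i]}) : {ae P, forall t, repr (\pi_L0 f) t = f t}.
Proof. by apply/pi_L0P; rewrite reprK. Qed.

Let L0_eq (x y : L0) : {ae P, forall t, repr x t = repr y t} -> x = y.
Proof. by move=> /pi_L0P; rewrite !reprK. Qed.

Let L0_addE x y : {ae P, forall t, repr (L0_add x y) t = repr x t + repr y t}.
Proof. exact: repr_pi. Qed.

Let L0_scaleE a x : {ae P, forall t, repr (L0_scale a x) t = a * repr x t}.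
Proof. exact: repr_pi. Qed.

Let L0_zeroE : {ae P, forall t, repr L0_zero t = 0}.
Proof. exact: repr_pi. Qed.

Let L0_addA : associative L0_add.
Proof.
move=> x y z; apply: L0_eq.
apply: filterS3 (L0_addE x (L0_add y z)) (L0_addE y z)
  (filterI (L0_addE (L0_add x y) z) (L0_addE x y)) => t -> -> [-> ->].
exact: addrA.
Qed.

Let L0_addC : commutative L0_add.
Proof.
move=> x y; apply: L0_eq.
by apply: filterS2 (L0_addE x y) (L0_addE y x) => t -> ->; exact: addrC.
Qed.

Let L0_add0 : left_id L0_zero L0_add.
Proof.
move=> x; apply: L0_eq.
by apply: filterS2 (L0_addE L0_zero x) L0_zeroE => t -> ->; exact: add0r.
Qed.

Let L0_addN : left_inverse L0_zero (L0_scale (-1)) L0_add.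
Proof.
move=> x; apply: L0_eq.
apply: filterS3 (L0_addE (L0_scale (-1) x) x) (L0_scaleE (-1) x) L0_zeroE
  => t -> -> ->; by rewrite mulN1r addNr.
Qed.

HB.instance Definition _ := GRing.isZmodule.Build L0
  L0_addA L0_addC L0_add0 L0_addN.

Let L0_scaleA a b x : L0_scale a (L0_scale b x) = L0_scale (a * b) x.
Proof.
apply: L0_eq.
apply: filterS3 (L0_scaleE a (L0_scale b x)) (L0_scaleE b x) (L0_scaleE (a * b) x)
  => t -> -> ->; exact: mulrA.
Qed.

Let L0_scale1 : left_id 1 L0_scale.
Proof.
move=> x; apply: L0_eq.
by apply: filterS (L0_scaleE 1 x) => t ->; exact: mul1r.
Qed.

Let L0_scaleDr : right_distributive L0_scale +%R.
Proof.
move=> a x y; apply: L0_eq.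
apply: filterS3 (L0_scaleE a (x + y)) (L0_addE x y)
  (filterI (L0_addE (L0_scale a x) (L0_scale a y))
    (filterI (L0_scaleE a x) (L0_scaleE a y)))
  => t -> -> [-> [-> ->]]; exact: mulrDr.
Qed.

Let L0_scaleDl x : {morph L0_scale^~ x : a b / a + b}.
Proof.
move=> a b; apply: L0_eq.
apply: filterS3 (L0_scaleE (a + b) x) (L0_addE (L0_scale a x) (L0_scale b x))
    (filterI (L0_scaleE a x) (L0_scaleE b x))
  => t -> -> [-> ->]; exact: mulrDl.
Qed.

HB.instance Definition _ := GRing.Zmodule_isLmodule.Build R[i] L0
  L0_scaleA L0_scale1 L0_scaleDr L0_scaleDl.

Lemma repr_L0D (x y : L0) : {ae P, forall t, repr (x + y) t = repr x t + repr y t}.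
Proof. exact: L0_addE. Qed.

Lemma repr_L0Z (a : R[i]) (x : L0) : {ae P, forall t, repr (a *: x) t = a * repr x t}.
Proof. exact: L0_scaleE. Qed.

Lemma repr_L0N (x : L0) : {ae P, forall t, repr (- x) t = - repr x t}.
Proof. by apply: filterS (L0_scaleE (-1) x) => t ->; rewrite mulN1r. Qed.

(* For k > 0 these form a basis of neighbourhoods of 0. The first comparison is
   the one of R[i], where it holds between real numbers only. *)
Definition L0_W (k : nat) : set L0 :=
  [set \pi_L0 f | f in [set f : {mfun T >-> R[i]} |
    (P [set t | (k%:R^-1 <= `|f t|)%R] < (k%:R^-1)%:E)%E]].

HB.instance Definition _ := hasNbhs.Build L0 (fun x =>
  filter_from [set k | (0 < k)%N] (fun k => [set y | L0_W k (y - x)])).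

Let big (e : R) (x : L0) := P [set t | e <= ComplexField.Normc.normc (repr x t)].

Let measurable_big e (f : {mfun T >-> R[i]}) :
  measurable [set t | e <= ComplexField.Normc.normc (f t)].
Proof.
rewrite (_ : [set t | _] = (@ComplexField.Normc.normc R \o f) @^-1` `[e, +oo[).
  rewrite -[X in measurable X]setTI.
  by apply: (measurableT_comp measurable_normc).
by apply/seteqP; split => t /=; rewrite in_itv/= andbT.
Qed.

Let ae_big_le e (x : L0) (B : set T) : measurable B ->
  {ae P, forall t, e <= ComplexField.Normc.normc (repr x t) -> B t} ->
  (big e x <= P B)%E.
Proof.
move=> mB [N [mN PN0 BN]].
rewrite -[leRHS]adde0 -PN0.
apply: le_trans (measureU2 _ mB mN).
apply: le_measure; rewrite ?inE; [exact: measurable_big|exact: measurableU|].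
move=> t /= et; have [Bt|nBt] := pselect (B t); [by left|right].
by apply: BN => /= /(_ et).
Qed.

Lemma L0_W_E k x : (0 < k)%N -> L0_W k x <-> (big k%:R^-1 x < (k%:R^-1)%:E)%E.
Proof.
move=> k0.
have kC : k%:R^-1 = (k%:R^-1 : R)%:C%C by rewrite fmorphV rmorph_nat.
have E (f : {mfun T >-> R[i]}) : [set t | k%:R^-1 <= `|f t|] =
    [set t | (k%:R^-1 : R) <= ComplexField.Normc.normc (f t)].
  by apply/seteqP; split => t /=; rewrite kC lecR.
split=> [[f]|].
  rewrite /= E => + <-; apply: le_lt_trans.
  apply: ae_big_le; first exact: measurable_big.
  by apply: filterS (repr_pi f) => t ->.
move=> h; exists (repr x); last exact: reprK.
by rewrite /= E.
Qed.

Let big_sub e (x y : L0) : {ae P, forall t,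
    ComplexField.Normc.normc (repr x t) <= ComplexField.Normc.normc (repr y t)} ->
  (big e x <= big e y)%E.
Proof.
move=> xy; apply: ae_big_le; first exact: measurable_big.
by apply: filterS xy => t xy /= et; exact: le_trans et xy.
Qed.

Let normcN (z : R[i]) : ComplexField.Normc.normc (- z) = ComplexField.Normc.normc z.
Proof. by case: z => a b /=; rewrite !sqrrN. Qed.

Let normcD (z w : R[i]) : ComplexField.Normc.normc (z + w) <=
  ComplexField.Normc.normc z + ComplexField.Normc.normc w.
Proof. by have := ler_normD z w; rewrite -[_ + _ in X in _ <= X]rmorphD lecR. Qed.

Lemma L0_W_N k x : (0 < k)%N -> L0_W k x -> L0_W k (- x).
Proof.
move=> k0 /(L0_W_E _ k0) xk; apply/(L0_W_E _ k0); apply: le_lt_trans xk.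
by apply: big_sub; apply: filterS (repr_L0N x) => t ->; rewrite normcN.
Qed.

Lemma L0_W_0 k : (0 < k)%N -> L0_W k 0.
Proof.
move=> k0; apply/(L0_W_E _ k0).
apply: (@le_lt_trans _ _ (P set0)); last by rewrite measure0 lte_fin invr_gt0 ltr0n.
apply: ae_big_le => //; apply: filterS L0_zeroE => t ->.
by rewrite ComplexField.Normc.normc0 leNgt invr_gt0 ltr0n k0.
Qed.

Lemma L0_W_anti k l x : (0 < k)%N -> (k <= l)%N -> L0_W l x -> L0_W k x.
Proof.
move=> k0 kl; have l0 := leq_trans k0 kl.
have lk : (l%:R^-1 <= k%:R^-1 :> R) by rewrite lef_pV2 ?posrE ?ltr0n// ler_nat.
move=> /(L0_W_E _ l0) xl; apply/(L0_W_E _ k0).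
apply: (@lt_le_trans _ _ (l%:R^-1)%:E); last by rewrite lee_fin.
apply: le_lt_trans xl; apply: ae_big_le; first exact: measurable_big.
by apply: aeW => t /=; exact: le_trans.
Qed.

Let half_inv k : (k.*2%:R^-1 + k.*2%:R^-1 = k%:R^-1 :> R).
Proof.
rewrite -mulr2n -muln2 natrM invfM -mulrnAr -[2^-1 *+ 2]mulr_natl.
by rewrite divff ?mulr1 ?pnatr_eq0.
Qed.

Lemma L0_W_D k x y : (0 < k)%N -> L0_W k.*2 x -> L0_W k.*2 y -> L0_W k (x + y).
Proof.
move=> k0; have k20 : (0 < k.*2)%N by rewrite double_gt0.
move=> /(L0_W_E _ k20) xk /(L0_W_E _ k20) yk; apply/(L0_W_E _ k0).
apply: (@le_lt_trans _ _ (big k.*2%:R^-1 x + big k.*2%:R^-1 y)%E); last first.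
  by rewrite -(half_inv k) EFinD; apply: lteD.
apply: le_trans (measureU2 _ (measurable_big _ _) (measurable_big _ _)).
apply: ae_big_le; first by apply: measurableU; exact: measurable_big.
apply: filterS (repr_L0D x y) => t -> /= h.
have [xt|xt] := leP k.*2%:R^-1 (ComplexField.Normc.normc (repr x t)); first by left.
right; rewrite leNgt; apply/negP => yt.
by move: h; rewrite leNgt -(half_inv k) (le_lt_trans (normcD _ _))// ltrD.
Qed.

Let L0_nbhs_filter (x : L0) : ProperFilter (nbhs x).
Proof.
apply: filter_from_proper; last first.
  by move=> k k0; exists x; rewrite /= subrr; exact: L0_W_0.
apply: filter_from_filter; first by exists 1%N.
move=> k l k0 l0; exists (maxn k l); first by rewrite /= leq_max k0.
move=> y /= yx; split; [apply: (@L0_W_anti k (maxn k l))|apply: (@L0_W_anti l (maxn k l))] => //.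
- exact: leq_maxl.
- exact: leq_maxr.
Qed.

Let L0_nbhs_singleton (x : L0) (A : set L0) : nbhs x A -> A x.
Proof. by move=> [k k0]; apply => /=; rewrite subrr; exact: L0_W_0. Qed.

Let L0_nbhs_nbhs (x : L0) (A : set L0) : nbhs x A -> nbhs x (nbhs^~ A).
Proof.
move=> [k k0 kA]; have k20 : (0 < k.*2)%N by rewrite double_gt0.
exists k.*2 => // y /= yx; exists k.*2 => // z /= zy; apply: kA => /=.
by rewrite -(subrK y z) -addrA; exact: L0_W_D.
Qed.

HB.instance Definition _ := Nbhs_isNbhsTopological.Build L0
  L0_nbhs_filter L0_nbhs_singleton L0_nbhs_nbhs.

Lemma nbhs_L0E (x : L0) : nbhs x =
  filter_from [set k | (0 < k)%N] (fun k => [set y | L0_W k (y - x)]).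
Proof. by []. Qed.

Lemma nbhs_L0_W k (x : L0) : (0 < k)%N -> nbhs x [set y | L0_W k (y - x)].
Proof. by move=> k0; exists k. Qed.

Let L0_add_continuous : continuous (fun x : L0 * L0 => x.1 + x.2).
Proof.
move=> [x y] A [k k0 kA]; have k20 : (0 < k.*2)%N by rewrite double_gt0.
exists ([set z | L0_W k.*2 (z - x)], [set z | L0_W k.*2 (z - y)]).
  by split; exact: nbhs_L0_W.
move=> [z w] /= [zx wy]; apply: kA => /=.
by rewrite opprD addrACA; exact: L0_W_D.
Qed.

HB.instance Definition _ := PreTopologicalNmodule_isTopologicalNmodule.Build L0
  L0_add_continuous.

Let big_cvg0 (x : L0) (e : R) : 0 < e -> exists2 n, (0 < n)%N & (big n%:R x < e%:E)%E.
Proof.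
move=> e0.
pose F n := [set t | n%:R <= ComplexField.Normc.normc (repr x t)].
have F0 : \bigcap_n F n = set0.
  apply/seteqP; split => // t Ft.
  have := Ft (Num.bound (ComplexField.Normc.normc (repr x t))) I.
  rewrite /F/= leNgt => /negP; apply; apply: archi_boundP.
  by have := normr_ge0 (repr x t); rewrite ler0c.
have : (P \o F) n @[n --> \oo] --> P (\bigcap_n F n).
  apply: nonincreasing_cvg_mu => //.
  - by rewrite ltey_eq fin_num_measure//; exact: measurable_big.
  - by move=> n; exact: measurable_big.
  - by rewrite F0.
  - move=> m n mn; apply/subsetPset => t; rewrite /F/=; apply: le_trans.
    by rewrite ler_nat.
rewrite F0 measure0 => /fine_cvgP[_ /cvgrPdist_lt /(_ _ e0)] [N _ /(_ N.+1)].
rewrite /= leqnSn => /(_ isT); rewrite sub0r normrN ger0_norm ?fine_ge0// => h.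
exists N.+1 => //; rewrite /big -[P _]fineK ?lte_fin//.
by apply: fin_num_measure; exact: measurable_big.
Qed.

Let L0_scale_continuous : continuous (fun z : R[i]^o * L0 => z.1 *: z.2).
Proof.
move=> [a x] A [k k0 kA].
have k20 : (0 < k.*2)%N by rewrite double_gt0.
pose M := ComplexField.Normc.normc a + 1.
have na : 0 <= ComplexField.Normc.normc a.
  by have := normr_ge0 a; rewrite ler0c.
have M0 : 0 < M by rewrite ltr_wpDl.
have k2i : 0 < k.*2%:R^-1 :> R by rewrite invr_gt0 ltr0n.
have [n n0 nx] := big_cvg0 x k2i.
pose dl : R := Num.min 1 (k.*2%:R^-1 / n%:R).
have dl0 : 0 < dl by rewrite lt_min ltr01 divr_gt0// ltr0n.
pose l := (k.*2 * (Num.bound M).+1)%N.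
have l0 : (0 < l)%N by rewrite muln_gt0 k20.
exists (ball a dl%:C%C, [set z | L0_W l (z - x)]).
  split; last exact: nbhs_L0_W.
  by apply: nbhsx_ballx; rewrite ltcR.
move=> [b y] /= [ab yx]; apply: kA => /=.
have {}ab : ComplexField.Normc.normc (b - a) < dl.
  by move: ab; rewrite -ball_normE/= distrC ltcR.
have bM : ComplexField.Normc.normc b <= M.
  rewrite -(subrK a b) addrC (le_trans (normcD _ _))// lerD2l.
  by rewrite (le_trans (ltW ab))// ge_min lexx.
have -> : b *: y - a *: x = b *: (y - x) + (b - a) *: x.
  by rewrite scalerBr scalerBl addrA subrK.
apply: L0_W_D => //; apply/L0_W_E => //.
- move: yx => /(L0_W_E _ l0) yx.
  have ll : l%:R^-1 <= k.*2%:R^-1 :> R.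
    by rewrite lef_pV2 ?posrE ?ltr0n// ler_nat leq_pmulr.
  apply: (@lt_le_trans _ _ (l%:R^-1)%:E); last by rewrite lee_fin.
  apply: le_lt_trans yx; apply: ae_big_le; first exact: measurable_big.
  apply: filterS (repr_L0Z b (y - x)) => t -> /=.
  rewrite ComplexField.Normc.normcM => h.
  have Ml : M <= (Num.bound M).+1%:R.
    rewrite (le_trans (ltW (archi_boundP (ltW M0))))// ler_nat//.
  rewrite /l natrM invfM ler_pdivrMr ?ltr0n//.
  apply: (le_trans h); rewrite mulrC ler_wpM2l//.
    by have := normr_ge0 (repr (y - x) t); rewrite ler0c.
  exact: le_trans bM Ml.
- apply: le_lt_trans nx; apply: ae_big_le; first exact: measurable_big.
  apply: filterS (repr_L0Z (b - a) x) => t -> /=.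
  rewrite ComplexField.Normc.normcM => h.
  have nx0 : 0 <= ComplexField.Normc.normc (repr x t).
    by have := normr_ge0 (repr x t); rewrite ler0c.
  rewrite leNgt; apply/negP => xn.
  move: h; rewrite leNgt => /negP; apply.
  have : dl <= k.*2%:R^-1 / n%:R by rewrite ge_min lexx orbT.
  rewrite ler_pdivlMr ?ltr0n// => /(lt_le_trans _); apply.
  apply: (@le_lt_trans _ _ (dl * ComplexField.Normc.normc (repr x t))).
    by rewrite ler_wpM2r// ltW.
  by rewrite ltr_pM2l.
Qed.

HB.instance Definition _ := TopologicalNmodule_isTopologicalLmodule.Build R[i] L0
  L0_scale_continuous.

Lemma hausdorff_L0 : hausdorff_space L0.
Proof.
move=> x y xy; apply/eqP; rewrite eq_sym -subr_eq0; apply/eqP.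
have W k : (0 < k)%N -> L0_W k (y - x).
  move=> k0; have k20 : (0 < k.*2)%N by rewrite double_gt0.
  have [z [/= zx zy]] := xy _ _ (nbhs_L0_W x k20) (nbhs_L0_W y k20).
  by rewrite -(subrK z y) -addrA; apply: L0_W_D => //; rewrite -opprB; exact: L0_W_N.
have big0 k : (0 < k)%N -> big k%:R^-1 (y - x) = 0%E.
  move=> k0; apply/eqP; rewrite eq_le measure_ge0 andbT.
  apply/lee_addgt0Pr => e e0; rewrite add0e.
  pose l := maxn k (Num.bound e^-1).+1.
  have l0 : (0 < l)%N by rewrite leq_max k0.
  have /(L0_W_E _ l0) Wl := W l l0.
  apply: (@le_trans _ _ (big l%:R^-1 (y - x))).
    apply: ae_big_le; first exact: measurable_big.
    apply: aeW => t /=; apply: le_trans.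
    by rewrite lef_pV2 ?posrE ?ltr0n// ler_nat leq_maxl.
  apply: (le_trans (ltW Wl)); rewrite lee_fin invf_ple ?posrE ?ltr0n//.
  apply: (le_trans (ltW (archi_boundP _))); first by rewrite invr_ge0 ltW.
  by rewrite ler_nat leq_max leqnSn orbT.
apply: L0_eq; apply: filterS2 (_ : {ae P, forall t, repr (y - x) t = 0}) L0_zeroE.
  by move=> t -> ->.
pose F k := [set t | k.+1%:R^-1 <= ComplexField.Normc.normc (repr (y - x) t)].
apply: (@negligibleS _ _ _ P (\bigcup_k F k)).
  move=> t /= /eqP rt.
  have nt : 0 < ComplexField.Normc.normc (repr (y - x) t).
    by have := normr_gt0 (repr (y - x) t); rewrite rt ltcR.
  exists (Num.bound (ComplexField.Normc.normc (repr (y - x) t))^-1) => //.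
  rewrite /F/= invf_ple ?posrE ?ltr0n//.
  apply: (le_trans (ltW (archi_boundP _))); first by rewrite invr_ge0 ltW.
  by rewrite ler_nat.
apply: negligible_bigcup => k; apply/negligibleP; first exact: measurable_big.
exact: big0.
Qed.

Definition L0_indic (A : set T) (mA : measurable A) : L0 :=
  \pi_L0 (mk_mfun (measurable_complex_indic mA)).

End L0.

Section class_C.
Context (K : numFieldType) (E : topologicalLmodType K).

Definition set_pow (U : set K) n : set 'rV[K]_n := [set x | forall i, U (x 0 i)].
Arguments set_pow : clear implicits.

(* [divided_difference U f k g] says that g is f^{<k>}, the continuous extension
   to U^(k+1) of the k-th divided difference of f, all lower-order ones existing
   too. Points of U^(k+1) are row vectors with indices starting at 0, so that
   col' 1 x = (x_1, x_3, ..., x_(k+1)) and col' 0 x = (x_2, x_3, ..., x_(k+1))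
   in the usual 1-based numbering. Values of g outside U^(k+1) are irrelevant. *)
Fixpoint divided_difference (U : set K) (f : K -> E) (k : nat) :
    ('rV[K]_k.+1 -> E) -> Prop :=
  match k with
  | 0 => fun g => {within set_pow U 1, continuous g} /\
      forall x, set_pow U 1 x -> g x = f (x 0 0)
  | k'.+1 => fun g => {within set_pow U k'.+2, continuous g} /\
      exists2 h : 'rV[K]_k'.+1 -> E, divided_difference U f h &
        forall x, set_pow U k'.+2 x -> x 0 0 != x 0 1 ->
          g x = (x 0 0 - x 0 1)^-1 *: (h (col' 1 x) - h (col' 0 x))
  end.

Definition class_C (U : set K) (f : K -> E) (k : nat) :=
  exists g : 'rV[K]_k.+1 -> E, divided_difference U f g.

Definition class_Coo (U : set K) (f : K -> E) := forall k, class_C U f k.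

End class_C.

Section example.
Context (R : realType).

Definition annulus (z : R[i]) : set R[i] := [set w | `|z| <= `|w| <= 1].

Lemma measurable_annulus (z : R[i]) : measurable (annulus z).
Proof.
rewrite (_ : annulus z = @ComplexField.Normc.normc R @^-1`
    `[ComplexField.Normc.normc z, 1]).
  rewrite -[X in measurable X]setTI.
  by apply: measurable_normc.
have lez u v : (`|u| <= `|v| :> R[i]) =
    (ComplexField.Normc.normc u <= ComplexField.Normc.normc v) by exact: lecR.
have le1 v : (`|v| <= 1 :> R[i]) = (ComplexField.Normc.normc v <= 1).
  exact: (lecR _ 1).
by apply/seteqP; split => w /=; rewrite /annulus/= in_itv/= ?lez ?le1.
Qed.

Definition annulus_indic (z : R[i]) : L0 (gauss_measure R) :=
  L0_indic (gauss_measure R) (measurable_annulus z).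

End example.

(* Main.v *)
(* For fixed w off the circles |w| = |x_i|, the function z |-> f(z)(w) is
   locally constant, with values 0 and 1, near each of the points x_i. Hence its
   divided difference at the x_i, coinciding points included, is the coefficient
   of t^(n-1) in the polynomial of degree < n that is 1 modulo the product of
   the t - x_i with value 1 and 0 modulo the product of the others. Splitting
   off one point of each kind by the recurrence shows that this coefficient is
   continuous in x as long as the values do not change. When x moves slightly,
   they change only for w in thin shells around the circles |w| = |x_i|; the
   circles are null, so these shells have small measure, and in the topology of
   convergence in measure the size of the functions on them is irrelevant. *)

Require Import Defs.
From HB Require Import structures.
From mathcomp Require Import all_boot all_order all_algebra.
From mathcomp Require Import complex.
From mathcomp Require Import all_classical all_reals all_analysis.
From mathcomp Require Import measurable_realfun normal_distribution.
From mathcomp Require Import ring lra.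

Set Implicit Arguments.
Unset Strict Implicit.
Unset Printing Implicit Defensive.
Import Order.TTheory GRing.Theory Num.Theory.
Import numFieldNormedType.Exports.
Local Open Scope classical_set_scope.
Local Open Scope ring_scope.

Local Notation normc := ComplexField.Normc.normc.

(** * Interpolation of 0-1 labels and its divided differences *)

Section divided_difference_of_labels.
Context (K : fieldType).
Implicit Types (n : nat).

Definition label_poly n (b : 'I_n -> bool) (x : 'rV[K]_n) : {poly K} :=
  \prod_i (if b i then 'X - (x 0 i)%:P else 1).

Definition separated n (b : 'I_n -> bool) (x : 'rV[K]_n) :=
  forall i j, b i -> ~~ b j -> x 0 i != x 0 j.

(** Congruences modulo products, instead of prescribed values, take multiplicities into account
    where points coincide. *)
Definition label_interp n (b : 'I_n -> bool) (x : 'rV[K]_n) (p : {poly K}) :=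
  [/\ (size p <= n)%N, label_poly b x %| p - 1 & label_poly (predC b) x %| p].

(* The divided difference at the points x_i of a function that is constantly b i
   near x_i; a junk value if two equal points have different labels. *)
Definition label_dd n (b : 'I_n -> bool) (x : 'rV[K]_n) : K :=
  (xget 0 [set p | label_interp b x p])`_n.-1.

Lemma size_prod_XsubC_ord n (F : 'I_n -> K) :
  size (\prod_i ('X - (F i)%:P)) = n.+1.
Proof. by rewrite -big_enum /= size_prod_XsubC size_enum_ord. Qed.

Lemma label_polyC n (b : 'I_n -> bool) x :
  label_poly b x * label_poly (predC b) x = \prod_i ('X - (x 0 i)%:P).
Proof.
rewrite -big_split; apply: eq_bigr => i _ /=.
by case: (b i); rewrite ?mulr1 ?mul1r.
Qed.

Lemma size_label_polyC n (b : 'I_n -> bool) x :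
  size (label_poly b x * label_poly (predC b) x) = n.+1.
Proof. by rewrite label_polyC size_prod_XsubC_ord. Qed.

Lemma label_poly_col' n (b : 'I_n.+1 -> bool) x j :
  label_poly b x = (if b j then 'X - (x 0 j)%:P else 1) *
                   label_poly (b \o lift j) (col' j x).
Proof.
rewrite /label_poly (bigD1_ord j)//; congr (_ * _).
by apply: eq_bigr => i _; rewrite !mxE.
Qed.

Lemma coprimep_label_poly n (b : 'I_n -> bool) x : separated b x ->
  coprimep (label_poly b x) (label_poly (predC b) x).
Proof.
move=> sb; rewrite /label_poly.
apply: (big_ind (fun p => coprimep p _)); first exact: coprime1p.
  by move=> p q hp hq; rewrite coprimepMl hp.
move=> i _; case: ifPn => bi; last exact: coprime1p.
apply: (big_ind (fun p => coprimep _ p)); first exact: coprimep1.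
  by move=> p q hp hq; rewrite coprimepMr hp.
move=> j _ /=; case: ifPn => bj; last exact: coprimep1.
by rewrite coprimep_XsubC2// subr_eq0 eq_sym sb.
Qed.

Lemma separated_col' n (b : 'I_n.+1 -> bool) x j :
  separated b x -> separated (b \o lift j) (col' j x).
Proof. by move=> sb i k /= bi bk; rewrite !mxE sb. Qed.

(** Chinese remainder theorem: a Bezout relation between the two coprime label polynomials yields a
    solution, and reducing it modulo their product, which has degree [n], gives the size bound. *)
Lemma label_interp_ex n (b : 'I_n -> bool) x : separated b x ->
  exists p, label_interp b x p.
Proof.
move=> sb; set P := label_poly b x; set Q := label_poly (predC b) x.
have PQ0 : P * Q != 0 by rewrite -size_poly_eq0 size_label_polyC.
have /Bezout_coprimepP[[u v] /= uv] := coprimep_label_poly sb.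
(* The Bezout combination is only associate to 1, hence a nonzero constant [c]. *)
have [c c0 Ec] : exists2 c, c != 0 & u * P + v * Q = c%:P.
  move: uv => /eqpP[[c1 c2] /= /andP[c10 c20] E]; exists (c1^-1 * c2).
    by rewrite mulf_neq0// invr_eq0.
  by rewrite -[LHS](scale1r) -(mulVf c10) -scalerA E scalerA alg_polyC.
exists ((c^-1 *: (v * Q)) %% (P * Q)); split.
- by have := ltn_modp (c^-1 *: (v * Q)) (P * Q); rewrite PQ0 size_label_polyC.
- set r := c^-1 *: (v * Q).
  have -> : r %% (P * Q) - 1 = - (r %/ (P * Q) * (P * Q)) - c^-1 *: (u * P).
    have -> : r %% (P * Q) = r - r %/ (P * Q) * (P * Q).
      by rewrite {2}(divp_eq r (P * Q)) addrAC subrr add0r.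
    rewrite addrAC addrC; congr (_ + _).
    apply/eqP; rewrite subr_eq addrC -subr_eq opprK -scalerDr addrC Ec.
    by rewrite -mul_polyC -polyCM mulVf.
  rewrite dvdp_sub ?dvdpNr//; first by rewrite dvdp_mull// dvdp_mulr.
  by rewrite -mul_polyC dvdp_mull// dvdp_mull.
- rewrite -(dvdp_mod _ (dvdp_mull P (dvdpp Q))).
  by rewrite -mul_polyC dvdp_mull// dvdp_mull.
Qed.

(** The coprime label polynomials both divide [p - q], hence so does their product. This serves
    uniqueness as well as the comparison of interpolants at different numbers of points. *)
Lemma label_interp_eqmod n (b : 'I_n -> bool) x p q : separated b x ->
  label_poly b x %| p - 1 -> label_poly (predC b) x %| p ->
  label_poly b x %| q - 1 -> label_poly (predC b) x %| q ->
  \prod_i ('X - (x 0 i)%:P) %| p - q.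
Proof.
move=> sb p1 p2 q1 q2.
rewrite -(label_polyC b) Gauss_dvdp ?coprimep_label_poly// (dvdp_sub p2 q2) andbT.
have -> : p - q = (p - 1) - (q - 1) by ring.
exact: dvdp_sub.
Qed.

(** Uniqueness: two interpolants of size at most [n] differ by a multiple of a polynomial of degree
    [n], so they coincide. *)
Lemma label_ddE n (b : 'I_n -> bool) x p : separated b x ->
  label_interp b x p -> label_dd b x = p`_n.-1.
Proof.
move=> sb hp; rewrite /label_dd; congr (_ _ _); congr polyseq.
have [q hq] := label_interp_ex sb.
case: xgetP => [r _ [sr r1 r2]|/(_ q)//]; case: hp => sp p1 p2.
have [->//|] := eqVneq (r : {poly K}) p. rewrite -subr_eq0 => rp.
have := dvdp_leq rp (label_interp_eqmod sb r1 r2 p1 p2).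
rewrite size_prod_XsubC_ord leqNgt ltnS.
by rewrite (leq_trans (size_polyD _ _))// size_polyN geq_max sr.
Qed.

Lemma label_interp_cst n (b : 'I_n.+1 -> bool) x a : (forall i, b i = a) ->
  label_interp b x a%:R%:P.
Proof.
move=> ba; split; first exact: (leq_trans (size_polyC_leq1 _)).
- case: a ba => ba; first by rewrite subrr dvdp0.
  by rewrite /label_poly big1 ?dvd1p// => i _; rewrite ba.
- case: a ba => ba; last by rewrite dvdp0.
  by rewrite /label_poly big1 ?dvd1p// => i _ /=; rewrite ba.
Qed.

(** The coefficient covers two cases: [a] for a single point, 0 for several points. *)
Lemma label_dd_cst n (b : 'I_n.+1 -> bool) x a : (forall i, b i = a) ->
  label_dd b x = (a%:R%:P : {poly K})`_n.
Proof.
move=> ba; have sb : separated b x by move=> i j; rewrite !ba => ->.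
exact: label_ddE sb (label_interp_cst x ba).
Qed.

(** Newton's form of the interpolant: [p - q] is a multiple of the monic product over the remaining
    [n.+1] points and has degree at most [n.+1], so the factor is constant. *)
Lemma label_interp_col' n (b : 'I_n.+2 -> bool) x p q j : separated b x ->
  label_interp b x p -> label_interp (b \o lift j) (col' j x) q ->
  p = q + p`_n.+1 *: \prod_i ('X - (col' j x 0 i)%:P).
Proof.
move=> sb [sp p1 p2] [sq q1 q2].
set Q := \prod_i _.
have mQ : Q \is monic by exact: monic_prod_XsubC.
have sQ : size Q = n.+2 by rewrite size_prod_XsubC_ord.
have /dvdpP[r rE] : Q %| p - q.
  apply: label_interp_eqmod (separated_col' sb) _ _ q1 q2.
    by apply: dvdp_trans p1; rewrite (label_poly_col' b x j) dvdp_mull.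
  by apply: dvdp_trans p2; rewrite (label_poly_col' (predC b) x j) dvdp_mull.
have spq : (size (p - q)%R <= n.+2)%N.
  by rewrite (leq_trans (size_polyD _ _))// size_polyN geq_max sp ltnW.
have /size1_polyC rc : (size r <= 1)%N.
  have [->|r0] := eqVneq r 0; first by rewrite size_poly0.
  by move: spq; rewrite rE size_Mmonic// sQ addnS -[n.+2]add1n leq_add2r.
suff -> : p`_n.+1 = r`_0 by rewrite -mul_polyC -rc -rE addrC subrK.
(* [q] has size at most [n.+1] and contributes nothing to this coefficient. *)
have -> : p`_n.+1 = (p - q)`_n.+1 by rewrite coefB [X in _ - X]nth_default ?subr0.
rewrite rE {1}rc coefCM.
by move/monicP: mQ; rewrite lead_coefE sQ /= => ->; rewrite mulr1.
Qed.

(** The coefficients of degree [n] are compared in the two Newton forms of [p] obtained by removing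
    point [i] and point [j]. *)
Lemma label_dd_recurrence n (b : 'I_n.+2 -> bool) x i j : separated b x ->
  (x 0 i - x 0 j) * label_dd b x =
  label_dd (b \o lift j) (col' j x) - label_dd (b \o lift i) (col' i x).
Proof.
move=> sb; have [p hp] := label_interp_ex sb.
have [q hq] := label_interp_ex (separated_col' (j := j) sb).
have [r hr] := label_interp_ex (separated_col' (j := i) sb).
rewrite (label_ddE sb hp) (label_ddE (separated_col' sb) hq).
rewrite (label_ddE (separated_col' sb) hr) /=.
have := label_interp_col' sb hp hq; have := label_interp_col' sb hp hr.
set c := p`_n.+1; set Qi := \prod_l ('X - (col' i _ _ _)%:P).
set Qj := \prod_l ('X - (col' j _ _ _)%:P) => pi pj.
have top k : (\prod_l ('X - (col' k x 0 l)%:P))`_n.+1 = 1.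
  have /monicP := monic_prod_XsubC (index_enum 'I_n.+1) predT (fun l => col' k x 0 l).
  by rewrite lead_coefE size_prod_XsubC_ord.
have full k : \prod_l ('X - (x 0 l)%:P) =
    ('X - (x 0 k)%:P) * \prod_l ('X - (col' k x 0 l)%:P).
  by rewrite (bigD1_ord k)//; congr (_ * _); apply: eq_bigr => l _; rewrite !mxE.
(* Expanding the full product in two ways relates the coefficients of degree [n] of [Qi] and
   [Qj]. *)
have := congr1 (coefp n.+1) (etrans (esym (full i)) (full j)).
rewrite /= -/Qi -/Qj !mulrBl !coefB !coefXM !coefCM /= !top !mulr1 => E.
have := congr1 (coefp n) (etrans (esym pi) pj).
rewrite /= !coefD !coefZ => /eqP; rewrite -subr_eq => /eqP <-.
have -> : Qj`_n = Qi`_n - x 0 i + x 0 j by rewrite E subrK.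
ring.
Qed.

End divided_difference_of_labels.

(** * Continuity of the divided differences for fixed labels *)

Lemma near_separated (K : numFieldType) T (F : set_system T) (FF : Filter F)
    n (b : 'I_n -> bool) (X : T -> 'rV[K]_n) (a : 'rV[K]_n) : separated b a ->
  (forall i, X t 0 i @[t --> F] --> (a 0 i : K)) ->
  \forall t \near F, separated b (X t).
Proof.
move=> sa Xa; apply: filter_forall => i; apply: filter_forall => j.
have [bi|bi] := boolP (b i); last exact: nearW.
have [bj|bj] := boolP (b j); first exact: nearW.
have : X t 0 i - X t 0 j @[t --> F] --> (a 0 i - a 0 j : K) by apply: cvgB; exact: Xa.
move=> /cvgr_neq0; rewrite subr_eq0 => /(_ (sa _ _ bi bj)).
by apply: filterS => t; rewrite subr_eq0.
Qed.

(** A family [X] along an arbitrary filter lets the induction hypothesis apply to [col' k (X t)]. *)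
Lemma label_dd_cvg (K : numFieldType) T (F : set_system T) (FF : Filter F)
    n (b : 'I_n.+1 -> bool) (X : T -> 'rV[K]_n.+1) (a : 'rV[K]_n.+1) : separated b a ->
  (forall i, X t 0 i @[t --> F] --> (a 0 i : K)) ->
  label_dd b (X t) @[t --> F] --> (label_dd b a : K).
Proof.
have const m (c : 'I_m.+1 -> bool) (Y : T -> 'rV[K]_m.+1) y a0 :
    (forall i, c i = a0) -> label_dd c (Y t) @[t --> F] --> (label_dd c y : K).
  move=> ca; rewrite (label_dd_cst y ca).
  by under eq_fun do rewrite (label_dd_cst _ ca); exact: cvg_cst.
elim: n b X a => [|n IH] b X a sa Xa.
  by apply: (const _ _ _ _ (b ord0)) => i; rewrite ord1.
have [/existsP[p bp]|] := boolP [exists p, b p]; last first.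
  move=> /existsPn nb; apply: (const _ _ _ _ false) => i.
  exact: negbTE (nb i).
have [/existsP[q bq]|] := boolP [exists q, ~~ b q]; last first.
  move=> /existsPn nb; apply: (const _ _ _ _ true) => i.
  exact: negbNE (nb i).
(* The labels of [p] and [q] differ, so separation makes [x 0 p - x 0 q] nonzero and the recurrence
   can be solved for [label_dd b x]. *)
have E (x : 'rV[K]_n.+2) : separated b x -> label_dd b x = (x 0 p - x 0 q)^-1 *
    (label_dd (b \o lift q) (col' q x) - label_dd (b \o lift p) (col' p x)).
  move=> sx; rewrite -(label_dd_recurrence _ _ sx) mulKf// subr_eq0.
  exact: sx.
rewrite (E _ sa).
have near_E : \forall t \near F, (X t 0 p - X t 0 q)^-1 *
    (label_dd (b \o lift q) (col' q (X t)) - label_dd (b \o lift p) (col' p (X t))) =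
    label_dd b (X t).
  by apply: filterS (near_separated FF sa Xa) => t /E.
apply: cvg_trans (near_eq_cvg near_E) _.
apply: cvgM.
  by apply: cvgV; [rewrite subr_eq0; exact: sa|apply: cvgB; exact: Xa].
have col k : label_dd (b \o lift k) (col' k (X t)) @[t --> F] -->
    (label_dd (b \o lift k) (col' k a) : K).
  apply: IH; first exact: separated_col'.
  by move=> i; rewrite mxE; under eq_fun do rewrite mxE; exact: Xa.
by apply: cvgB; exact: col.
Qed.

(** * Gauss measure of countable sets, circles, shells and the disc *)

Lemma gauss_measure1_countable (R : realType) (A : set R) :
  measurable A -> countable A -> gauss_measure1 A = 0%E.
Proof.
move=> mA cA; rewrite gauss_measure1E.
have /null_content_dominatesP := @normal_prob_dominates R 0 (Num.sqrt 2)^-1.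
by apply => //; exact: countable_lebesgue_measure0.
Qed.

Lemma gauss_measureE (R : realType) (A : set R[i]) :
  gauss_measure R A =
  (gauss_measure1 (R := R) \x gauss_measure1 (R := R))%E (complex_of_pair @^-1` A).
Proof. by []. Qed.

Lemma measurable_annulus_shell (R : realType) (r d : R) :
  measurable [set w : R[i] | `|normc w - r| <= d].
Proof.
rewrite (_ : [set w | _] = @normc R @^-1` `[r - d, r + d]).
  by rewrite -[X in measurable X]setTI; exact: measurable_normc.
by apply/seteqP; split => w /=; rewrite in_itv/= ler_distl.
Qed.

(** The product measure integrates the measures of the vertical sections of the circle, each with at
    most two points. *)
Lemma gauss_measure_circle (R : realType) (r : R) :
  gauss_measure R [set w | normc w = r] = 0%E.
Proof.
have mC : measurable [set w : R[i] | normc w = r].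
  rewrite (_ : [set w | _] = @normc R @^-1` [set r])//.
  by rewrite -[X in measurable X]setTI; exact: measurable_normc.
rewrite gauss_measureE /product_measure1; apply: integral0_eq => x _ /=.
apply: gauss_measure1_countable; first exact: measurable_xsection.
apply: (@sub_countable _ _ _
  [set Num.sqrt (r ^+ 2 - x ^+ 2); - Num.sqrt (r ^+ 2 - x ^+ 2)]).
  apply: subset_card_le => y; rewrite /xsection /= inE /= => E.
  have {}E : y ^+ 2 = r ^+ 2 - x ^+ 2.
    rewrite -E sqr_sqrtr ?addr_ge0 ?sqr_ge0//; ring.
  rewrite -E sqrtr_sqr; have [y0|y0] := leP 0 y; first by left; rewrite ger0_norm.
  by right; rewrite ltr0_norm// opprK.
apply: finite_set_countable; exact: finite_set2.
Qed.

(** Continuity from above: the shells of half-width [n.+1%:R^-1] decrease to a null circle. *)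
Lemma gauss_measure_shell (R : realType) (r e : R) : 0 < e ->
  exists2 d : R, 0 < d & (gauss_measure R [set w | (`|normc w - r| <= d)%R] < e%:E)%E.
Proof.
move=> e0; pose F n := [set w : R[i] | `|normc w - r| <= n.+1%:R^-1].
have FE : \bigcap_n F n = [set w : R[i] | normc w = r].
  apply/seteqP; split => w /=; last first.
    by move=> wr n _; rewrite /F/= wr subrr normr0 invr_ge0 ler0n.
  move=> Fw; apply/eqP; rewrite -subr_eq0 -normr_le0.
  apply/ler_addgt0Pr => x x0; rewrite add0r.
  apply: (le_trans (Fw (Num.bound x^-1) I)).
  rewrite invf_ple ?posrE ?ltr0n//.
  rewrite (le_trans (ltW (archi_boundP _)))// ?invr_ge0 ?ler_nat//.
  exact: ltW.
have : (gauss_measure R \o F) n @[n --> \oo] --> gauss_measure R (\bigcap_n F n).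
  apply: nonincreasing_cvg_mu => //.
  - by rewrite ltey_eq fin_num_measure//; exact: measurable_annulus_shell.
  - by move=> n; exact: measurable_annulus_shell.
  - by apply: bigcapT_measurable => n; exact: measurable_annulus_shell.
  - move=> m n mn; apply/subsetPset => t; rewrite /F/= => /le_trans; apply.
    by rewrite lef_pV2 ?posrE ?ltr0n// ler_nat.
rewrite FE gauss_measure_circle => /fine_cvgP[_ /cvgrPdist_lt /(_ _ e0)] [N _ /(_ N)].
rewrite /= leqnn => /(_ isT); rewrite sub0r normrN ger0_norm ?fine_ge0// => h.
exists N.+1%:R^-1; first by rewrite invr_gt0 ltr0n.
rewrite -[X in (X < _)%E]fineK ?lte_fin//.
have : gauss_measure R (F N) \is a fin_num; last exact.
by rewrite fin_num_measure//; exact: measurable_annulus_shell.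
Qed.

(** Induction on the list: [e] is split into halves and the smaller half-width is kept. *)
Lemma gauss_measure_shells (R : realType) (s : seq R) (e : R) : 0 < e ->
  exists d : R, [/\ 0 < d,
    measurable [set w : R[i] | has (fun r => `|normc w - r| <= d) s] &
    (gauss_measure R [set w | has (fun r => (`|normc w - r| <= d)%R) s]
      < e%:E)%E].
Proof.
have mS d (l : seq R) :
    measurable [set w : R[i] | has (fun r => `|normc w - r| <= d) l].
  elim: l => [|r l IH]; first rewrite [X in measurable X](_ : _ = set0)//.
    by apply/seteqP; split.
  rewrite (_ : [set w | _] = [set w : R[i] | `|normc w - r| <= d] `|`
    [set w : R[i] | has (fun r => `|normc w - r| <= d) l]).
    by apply: measurableU => //; exact: measurable_annulus_shell.
  by apply/seteqP; split => w /= => [/orP//|?]; apply/orP.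
elim: s e => [|r s IH] e e0.
  exists 1; split => //; rewrite [X in gauss_measure R X](_ : _ = set0) ?measure0//.
  by apply/seteqP; split.
have e20 : 0 < e / 2 by rewrite divr_gt0.
have [d1 [d10 _ h1]] := IH _ e20; have [d2 d20 h2] := gauss_measure_shell r e20.
exists (Num.min d1 d2); split => //; first by rewrite lt_min d10.
apply: (@le_lt_trans _ _ (gauss_measure R
   ([set w : R[i] | (`|normc w - r| <= d2)%R] `|`
    [set w : R[i] | has (fun r => `|normc w - r| <= d1)%R s]))).
  apply: le_measure; rewrite ?inE//.
    by apply: measurableU => //; exact: measurable_annulus_shell.
  move=> w /= /orP[|/hasP[q qs]]; rewrite le_min => /andP[wd1 wd2]; first by left.
  by right; apply/hasP; exists q.
apply: le_lt_trans (measureU2 _ (measurable_annulus_shell _ _) (mS _ _)) _.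
by rewrite [e]splitr EFinD; exact: (lteD h2 h1).
Qed.

(** The density is bounded below on the interval by its value [c] at [a]. *)
Lemma gauss_measure1_itv_gt0 (R : realType) (a : R) : 0 < a ->
  (0 < gauss_measure1 `[0%R, a])%E.
Proof.
move=> a0; pose c : R := (Num.sqrt pi)^-1 * expR (- a ^+ 2).
have sp : 0 < (Num.sqrt (pi : R))^-1 by rewrite invr_gt0 sqrtr_gt0 pi_gt0.
have c0 : 0 < c by rewrite mulr_gt0// expR_gt0.
apply: (@lt_le_trans _ _ (\int[lebesgue_measure]_(x in `[0%R, a]) (cst c%:E) x)%E).
  rewrite integral_cst//= lebesgue_measure_itv/= lte_fin a0 sube0 -EFinM lte_fin.
  exact: mulr_gt0.
apply: ge0_le_integral => //=. - by move=> x _; rewrite lee_fin ltW.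
- apply/measurable_EFinP; apply: measurable_funM => //.
  apply: measurableT_comp => //; apply: measurableT_comp => //.
- move=> x; rewrite in_itv/= => /andP[x0 xa].
  by rewrite lee_fin ler_pM2l// ler_expR lerN2 lerXn2r// nnegrE ltW.
Qed.

(** [annulus 0] is the closed unit disc, which contains a square of side 1/2 with positive product
    measure. *)
Lemma gauss_measure_disc_gt0 (R : realType) :
  (0 < gauss_measure R (annulus 0%R))%E.
Proof.
have h0 : 0 < 2^-1 :> R by rewrite invr_gt0.
have h (u v : R) : 0 <= u -> u <= 2^-1 -> 0 <= v -> v <= 2^-1 -> u ^+ 2 + v ^+ 2 <= 1.
  by move=> *; nra.
apply: (@lt_le_trans _ _ ((gauss_measure1 (R := R) \x gauss_measure1 (R := R))%E
  (`[0%R, 2^-1%R] `*` `[0%R, 2^-1%R]))).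
  by rewrite product_measure1E//= mule_gt0// gauss_measure1_itv_gt0.
rewrite gauss_measureE; apply: le_measure; rewrite ?inE//.
- exact: measurableX.
- exact: (measurable_annulus 0).
move=> [x y] /= []; rewrite !in_itv/= => /andP[x0 x1] /andP[y0 y1].
rewrite /annulus/= normr0 normr_ge0 /=.
have -> : 1 = 1%:C%C :> R[i] by [].
rewrite lecR -sqrtr1 ler_sqrt//.
exact: h.
Qed.

(** * Representatives of classes modulo almost everywhere equality *)

Section L0_pi.
Context d (T : measurableType d) (R : realType) (P : probability T R).
Local Open Scope quotient_scope.

Lemma repr_pi_L0 (f : {mfun T >-> R[i]}) :
  {ae P, forall t, repr (\pi_(L0 P) f) t = f t}.
Proof. by apply/pi_L0P; rewrite reprK. Qed.

Lemma L0_eq_ae (x y : L0 P) : {ae P, forall t, repr x t = repr y t} -> x = y.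
Proof. by move=> /pi_L0P; rewrite !reprK. Qed.

Lemma repr_L0B (x y : L0 P) :
  {ae P, forall t, repr (x - y) t = repr x t - repr y t}.
Proof. by apply: filterS2 (repr_L0D x (- y)) (repr_L0N y) => t -> ->. Qed.

End L0_pi.

(** * Divided differences of the annulus indicator *)

Section annulus_dd.
Context (R : realType).
Implicit Types (n : nat).
Local Open Scope quotient_scope.

Definition annulus_label n (x : 'rV[R[i]]_n) (w : R[i]) : 'I_n -> bool :=
  fun i => `|x 0 i| <= `|w| <= 1.

(** At a given [w], the label depends only on the point, so equal points never carry different
    labels. *)
Lemma annulus_label_separated n (x : 'rV[R[i]]_n) w :
  separated (annulus_label x w) x.
Proof.
by move=> i j; rewrite /annulus_label => bi; apply: contraNneq => <-.
Qed.

Lemma measurable_annulus_label n (x : 'rV[R[i]]_n) (b : 'I_n -> bool) :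
  measurable [set w | annulus_label x w = b].
Proof.
rewrite (_ : [set w | _] =
    \bigcap_(i in [set: 'I_n]) [set w | annulus_label x w i = b i]).
  apply: fin_bigcap_measurable => // i _.
  have mi := measurable_annulus (x 0 i).
  case: (b i); first exact: mi.
  rewrite (_ : [set w | _] = ~` annulus (x 0 i)); first exact: measurableC.
  by apply/seteqP; split => w; [move=> /negbT/negP|move=> /negP/negbTE].
apply/seteqP; split => w /= => [h i _|h]; first by rewrite /= h.
by apply/funext => i; exact: h.
Qed.

Definition annulus_dd_fun n (x : 'rV[R[i]]_n) (w : R[i]) : R[i] :=
  label_dd (annulus_label x w) x.

Lemma measurable_annulus_dd_fun n (x : 'rV[R[i]]_n) :
  measurable_fun setT (annulus_dd_fun x).
Proof.
move=> _ A mA; rewrite setTI.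
(* Labellings taken as finite functions form a finite type, so the preimage is a finite union. *)
rewrite (_ : _ @^-1` _ =
    \bigcup_(b in [set b : {ffun 'I_n -> bool} | A (label_dd b x)])
      [set w | annulus_label x w = b]).
  by apply: fin_bigcup_measurable => // b _; exact: measurable_annulus_label.
apply/seteqP; split => w /= => [Aw|[b Ab wb]]; last first.
  by rewrite /annulus_dd_fun wb.
have E : [ffun i => annulus_label x w i] = annulus_label x w :> ('I_n -> bool).
  by apply/funext => i; rewrite ffunE.
by exists [ffun i => annulus_label x w i] => /=; rewrite E.
Qed.

Definition annulus_dd n (x : 'rV[R[i]]_n) : L0 (gauss_measure R) :=
  \pi_(L0 (gauss_measure R)) (mk_mfun (measurable_annulus_dd_fun x)).

Lemma annulus_ddE n (x : 'rV[R[i]]_n) :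
  {ae gauss_measure R, forall w, repr (annulus_dd x) w = annulus_dd_fun x w}.
Proof. exact: repr_pi_L0. Qed.

Lemma annulus_dd1 (x : 'rV[R[i]]_1) : annulus_dd x = annulus_indic (x 0 0).
Proof.
apply/pi_L0P; apply: aeW => w /=.
rewrite /annulus_dd_fun (@label_dd_cst _ _ _ _ (annulus_label x w 0)); last first.
  by move=> i; rewrite ord1.
rewrite coefC /= indicE; congr (_%:R); congr nat_of_bool.
by apply/idP/idP; rewrite inE.
Qed.

Lemma annulus_dd_recurrence n (x : 'rV[R[i]]_n.+2) i j : x 0 i != x 0 j ->
  annulus_dd x =
  (x 0 i - x 0 j)^-1 *: (annulus_dd (col' j x) - annulus_dd (col' i x)).
Proof.
move=> xij; apply: L0_eq_ae.
set y := annulus_dd (col' j x); set z := annulus_dd (col' i x).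
apply: filterS3 (annulus_ddE x) (repr_L0Z (x 0 i - x 0 j)^-1 (y - z))
  (filterI (repr_L0B y z) (filterI (annulus_ddE (col' j x)) (annulus_ddE (col' i x)))).
move=> w -> -> [-> [-> ->]]; rewrite /annulus_dd_fun.
have E k : annulus_label (col' k x) w = annulus_label x w \o lift k.
  by apply/funext => l; rewrite /annulus_label /= mxE.
rewrite !E -label_dd_recurrence; last exact: annulus_label_separated.
by rewrite mulKf// subr_eq0.
Qed.

(** Moving the norm of a point by at most [d] cannot carry it across [|w|] when [|w|] is farther
    away than [d]. *)
Lemma annulus_label_eq n (x a : 'rV[R[i]]_n) w d :
  (forall i, `|normc (x 0 i) - normc (a 0 i)| <= d) ->
  (forall i, d < `|normc w - normc (a 0 i)|) ->
  annulus_label x w = annulus_label a w.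
Proof.
move=> xa wa; apply/funext => i; rewrite /annulus_label; congr andb.
rewrite !lecR; move: (xa i) (wa i).
rewrite ler_distl => /andP[h1 h2].
have [h|h] := leP (normc (a 0 i)) (normc w).
  by rewrite ger0_norm ?subr_ge0// => h3; apply/idP; lra.
by rewrite ltr0_norm ?subr_lt0// => h3; apply/negbTE; rewrite -ltNge; lra.
Qed.

Lemma annulus_dd_continuous n : continuous (@annulus_dd n.+1).
Proof.
move=> a A [m m0 mA].
have mi0 : 0 < m%:R^-1 :> R by rewrite invr_gt0 ltr0n.
have miC : m%:R^-1 = (m%:R^-1 : R)%:C%C by rewrite fmorphV rmorph_nat.
(* The exceptional set: shells around the circles through the [a 0 i], of measure below the bound
   that [L0_W m] allows. *)
have [d [d0 mB Bm]] := gauss_measure_shells [seq normc (a 0 i) | i : 'I_n.+1] mi0.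
have coordP (e : R[i]) : 0 < e -> \forall x \near a, forall i,
    `|a 0 i - (x : 'rV[R[i]]_n.+1) 0 i| < e.
  move=> e0.
  apply: (@filter_forall _ _
    (fun i (x : 'rV[R[i]]_n.+1) => `|a 0 i - x 0 i| < e) (nbhs a) _) => i.
  by have /cvgrPdist_lt /(_ _ e0) := @coord_continuous R[i] 1 n.+1 0 i a.
have near1 : \forall x \near a, forall i,
    `|normc ((x : 'rV[R[i]]_n.+1) 0 i) - normc (a 0 i)| <= d.
  have dC : 0 < d%:C%C :> R[i] by rewrite ltcR.
  apply: filterS (coordP _ dC) => x h i.
  have tri (u v : R[i]) : `|u - v| < d%:C%C -> normc u <= normc v + d.
    move=> uv; rewrite -lecR rmorphD -lerBlDl.
    exact: le_trans (lerB_dist u v) (ltW uv).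
  have := tri _ _ (h i); have := h i; rewrite distrC => /tri.
  by rewrite ler_distl => *; apply/andP; split; lra.
(* There are finitely many labellings, so one neighbourhood of [a] serves them all, hence all [w]
   simultaneously. *)
have near2 : \forall x \near a, forall b : {ffun 'I_n.+1 -> bool},
    separated b (a : 'rV[R[i]]_n.+1) -> `|label_dd b x - label_dd b a| < m%:R^-1.
  apply: (@filter_forall _ _
    (fun (b : {ffun 'I_n.+1 -> bool}) (x : 'rV[R[i]]_n.+1) =>
    separated b a -> `|label_dd b x - label_dd b a| < m%:R^-1) (nbhs a) _) => b.
  have [sb|nsb] := pselect (separated b a); last first.
    exact: nearW.
  have ba : label_dd b x @[x --> a] --> (label_dd b a : R[i]).
    apply: (@label_dd_cvg _ _ (nbhs a) _ _ _ id _ sb) => i; exact: coord_continuous.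
  have mi0' : 0 < m%:R^-1 :> R[i] by rewrite invr_gt0 ltr0n.
  by move/cvgrPdistC_lt : ba => /(_ _ mi0'); apply: filterS.
apply: filterS2 near1 near2 => x h1 h2; apply: mA => /=.
(* Membership in [L0_W m] asks for a representative: the difference of the two pointwise divided
   differences. *)
pose f := mk_mfun (measurable_complexD (measurable_annulus_dd_fun x)
  (measurable_complexZ (-1) (measurable_annulus_dd_fun a))).
exists f; last first.
  apply: L0_eq_ae; apply: filterS3 (repr_pi_L0 _ f) (repr_L0B (annulus_dd x) (annulus_dd a))
    (filterI (annulus_ddE x) (annulus_ddE a)) => w -> -> [-> ->] /=.
  by rewrite mulN1r.
apply: le_lt_trans Bm; apply: le_measure; rewrite ?inE//.
  rewrite (_ : [set w | _] = (@normc R \o f) @^-1` `[m%:R^-1, +oo[).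
    rewrite -[X in measurable X]setTI.
    exact: (measurableT_comp measurable_normc).
  by apply/seteqP; split => w /=; rewrite in_itv/= andbT miC lecR.
(* Contraposition: outside the shells, [x] and [a] have the same labels at [w], so [h2] bounds the
   difference. *)
move=> w /=; apply: contraTT; rewrite mulN1r -real_ltNge ?normr_real ?realV ?realn//.
move=> /hasPn nB.
have E : annulus_label x w = annulus_label a w.
  apply: annulus_label_eq h1 _ => i; rewrite ltNge; apply: nB.
  by apply/mapP; exists i; rewrite ?mem_enum.
have Ea : [ffun i => annulus_label a w i] = annulus_label a w :> ('I_n.+1 -> bool).
  by apply/funext => i; rewrite ffunE.
have := h2 [ffun i => annulus_label a w i]; rewrite Ea.
move=> /(_ (annulus_label_separated (x := a) (w := w))).
by rewrite /annulus_dd_fun E.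
Qed.

Lemma annulus_dd_divided_difference k :
  divided_difference [set: R[i]] (@annulus_indic R) (@annulus_dd k.+1).
Proof.
elim: k => [|k IH].
  split; first exact/continuous_subspaceT/annulus_dd_continuous.
  by move=> x _; exact: annulus_dd1.
split; first exact/continuous_subspaceT/annulus_dd_continuous.
by exists (@annulus_dd k.+1) => // x _; exact: annulus_dd_recurrence.
Qed.

End annulus_dd.

(** * Non-vanishing and compact support *)

Lemma annulus_indic_eq0 (R : realType) (z : R[i]) : 1 < `|z| -> annulus_indic z = 0.
Proof.
move=> z1; apply/(pi_L0P (gauss_measure R)); apply: aeW => w /=.
rewrite indicE memNset// /annulus /= => /andP[zw w1].
by move: (le_trans zw w1); rewrite lt_geF.
Qed.

(** Otherwise the closed unit disc, of positive measure, would be negligible. *)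
Lemma annulus_indic0_neq0 (R : realType) : annulus_indic (0 : R[i]) <> 0.
Proof.
move=> /(pi_L0P (gauss_measure R)) h.
have := gauss_measure_disc_gt0 R; rewrite lt0e => /andP[/eqP + _]; apply.
apply/negligibleP; first exact: measurable_annulus.
apply: negligibleS h => w wA /=; apply/eqP.
by rewrite indicE mem_set// oner_eq0.
Qed.

Lemma continuous_complex_of_pair (R : realType) : continuous (@complex_of_pair R).
Proof.
move=> [x y]; apply/cvgrPdist_lt => e e0.
(* A positive element of [R[i]] is real. *)
have eE : e = (complex.Re e)%:C%C.
  by apply/esym/RRe_real; rewrite gtr0_real.
have d0 : 0 < complex.Re e / 2.
  by rewrite divr_gt0//; move: e0; rewrite eE ltcR.
exists (ball x (complex.Re e / 2), ball y (complex.Re e / 2)).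
  by split; exact: nbhsx_ballx.
move=> [u v] /= []; rewrite -!ball_normE /= => xu yv.
rewrite eE normc_def ltcR /complex_of_pair /=.
apply: (@le_lt_trans _ _ (`|x - u| + `|y - v|)); last first.
  by rewrite [complex.Re e]splitr ltrD.
rewrite -[leRHS]ger0_norm ?addr_ge0// -sqrtr_sqr ler_sqrt ?sqr_ge0// [leRHS]sqrrD.
by rewrite !real_normK ?num_real// -addrA lerD2l lerDr mulrn_wge0// mulr_ge0.
Qed.

(** This square contains the closed unit disc, and thus the support. *)
Lemma compact_complex_box (R : realType) :
  compact (complex_of_pair @` (`[-1, 1] `*` `[-1, 1]) : set R[i]).
Proof.
apply: continuous_compact; last by apply: compact_setX; exact: segment_compact.
exact/continuous_subspaceT/continuous_complex_of_pair.
Qed.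

Theorem proposition2 (R : realType) :
  [/\ class_Coo [set: R[i]] (@annulus_indic R),
      @annulus_indic R <> (fun=> 0)
    & compact (closure [set z : R[i] | annulus_indic z <> 0])].
Proof.
split.
- by move=> k; exists (@annulus_dd R k.+1); exact: annulus_dd_divided_difference.
- by move=> /(congr1 (@^~ 0)); exact: annulus_indic0_neq0.
- have cK := @compact_complex_box R.
  apply: (subclosed_compact _ cK); first exact: closed_closure.
  (* The square is closed, being compact in a Hausdorff space, so it suffices that it contains the
     points where the function is nonzero. *)
  have /closure_id -> := compact_closed (@norm_hausdorff _ _) cK.
  apply: closureS => z fz; have : `|z| <= 1.
    rewrite real_leNgt ?real1 ?normr_real//; apply/negP => /annulus_indic_eq0.
    exact: fz.
  move=> z1; exists (complex.Re z, complex.Im z); last by case: (z).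
  split; rewrite /= in_itv /= -ler_norml -lecR.
    exact: le_trans (normc_ge_Re z) z1.
  apply: le_trans z1; rewrite normc_def lecR -sqrtr_sqr ler_sqrt.
    by rewrite lerDr sqr_ge0.
  by rewrite addr_ge0 ?sqr_ge0.
Qed.
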